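(* Let $G$ be a three dimensional Lie group with a bi-invariant metric, and let $\alpha:I\subset\mathbb{R}\to G$ be a curve parametrized by arc length $s$ with Frenet apparatus $(T,N,B,\varkappa,\tau)$. Then $\alpha$ is a Mannheim curve if and only if there is a constant $\lambda$ such that $$\lambda\,\varkappa(s)\,\bigl(1+H(s)^{2}\bigr)=1\quad\text{for all } s\in I,$$ where $H$ is the harmonic curvature function of $\alpha$.
   Context: $G$ is a three dimensional Lie group with bi-invariant metric $\langle\cdot,\cdot\rangle$, Levi-Civita connection $D$ and Lie algebra $\mathfrak{g}\cong T_eG$ of left-invariant fields, so $\langle X,[Y,Z]\rangle=\langle[X,Y],Z\rangle$ and $D_XY=\frac12[X,Y]$ for $X,Y,Z\in\mathfrak{g}$. Fix an orthonormal basis $X_1,X_2,X_3$ of $\mathfrak{g}$. A vector field $W$ along a curve $\alpha$ is written $W=\sum_i w_iX_i$ with smooth functions $w_i$ (so tangent vectors at different points are compared by left translation to $\mathfrak{g}$); the dot denotes the componentwise derivative $\dot W=\sum_i \dot w_iX_i$, and $D_{\alpha'}W=\dot W+\frac12[T,W]$ with $T=\alpha'$. Frenet apparatus $(T,N,B,\varkappa,\tau)$ of an arc length parametrized curve: $T=\alpha'$, and $\{T,N,B\}$ is an orthonormal frame along the curve with $B=T\times N$ (for a fixed orientation of $\mathfrak{g}$) satisfying $D_TT=\varkappa N$, $D_TN=-\varkappa T+\tau B$, $D_TB=-\tau N$, where $\varkappa=\|\dot T\|$. Put $\tau_G=\frac12\langle[T,N],B\rangle$. The harmonic curvature function is $H=\dfrac{\tau-\tau_G}{\varkappa}$.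 Mannheim curves: $\alpha:I\to G$ is a Mannheim curve if there is a curve $\beta:\overline I\to G$ and a bijective correspondence between the points of $\alpha$ and $\beta$ such that at corresponding points the principal normal $N$ of $\alpha$ and the binormal $B_\beta$ of $\beta$ are linearly dependent (in $\mathfrak{g}$), where $\beta$ is given by $\beta(s)=\alpha(s)+\lambda(s)N(s)$, $s\in I$, with $\lambda$ a smooth function on $I$; this relation is used through its derivative, computed componentwise: $\frac{d\beta}{ds}=T+\lambda' N+\lambda\dot N$, with $\frac{d\beta}{ds}=T_\beta\frac{d\overline s}{ds}$, $\overline s$ being the arc length of $\beta$. Then $\beta$ is called the Mannheim partner curve (Mannheim mate) of $\alpha$, and $(\alpha,\beta)$ a Mannheim curve couple.
   Formalization: The partner β enters only through its derivative T+λ'N+λN', since α+λN is undefined in G; β may be non-regular and its curvature may vanish or change sign (a circle in R³ satisfies the equation, but its mate is a point); ϰ>0 is assumed. *)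

(* Defs.v *)
From HB Require Import structures.
From mathcomp Require Import all_boot all_order all_algebra.
From mathcomp Require Import all_classical all_reals all_analysis.

Set Implicit Arguments.
Unset Strict Implicit.
Unset Printing Implicit Defensive.

Import Order.TTheory GRing.Theory Num.Theory.
Import numFieldNormedType.Exports.

Local Open Scope classical_set_scope.
Local Open Scope ring_scope.

(* Smooth means C^infinity throughout, and is always relative to an open set. *)

Fixpoint Ck (R : realType) (n k : nat) (U : set 'rV[R]_n)
    (f : 'rV[R]_n -> R) : Prop :=
  match k with
  | 0 => forall x, U x -> {for x, continuous f}
  | k'.+1 =>
      (forall x, U x -> differentiable f x) /\
      (forall i : 'I_n, Ck k' U (fun x => 'D_(delta_mx 0 i) f x))
  end.

Definition smooth_on (R : realType) (n : nat) (U : set 'rV[R]_n)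
    (f : 'rV[R]_n -> R) : Prop :=
  forall k, Ck k U f.

Definition smooth_on1 (R : realType) (I : set R) (f : R -> R) : Prop :=
  forall n s, I s -> derivable (derive1n n f) s 1.

HB.structure Definition TopologicalGroup := {G of Topological G & Group G}.
Notation topologicalGroupType := TopologicalGroup.type.

(* A chart is given by a pair of total maps, relevant only on [cdom] and on
   its image [cimg]. *)
Record chart (R : realType) (G : Type) := Chart {
  cdom : set G;
  cmap : G -> 'rV[R]_3;
  cinv : 'rV[R]_3 -> G }.

Definition cimg (R : realType) (G : Type) (c : chart R G) : set 'rV[R]_3 :=
  cmap c @` cdom c.

Record is_chart (R : realType) (G : topologicalType) (c : chart R G) : Prop :=
  IsChart {
  cdom_open : open (cdom c);
  cimg_open : open (cimg c);
  cmapK : {in cdom c, cancel (cmap c) (cinv c)};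
  cmap_cont : forall p, cdom c p -> {for p, continuous (cmap c)};
  cinv_cont : forall x, cimg c x -> {for x, continuous (cinv c)} }.

Record lie_group3 (R : realType) (G : topologicalGroupType) := LieGroup3 {
  atlas : set (chart R G);
  lg_hausdorff : hausdorff_space G;
  lg_second_countable : @second_countable G;
  atlas_chart : forall c, atlas c -> is_chart c;
  atlas_cover : forall p : G, exists2 c, atlas c & cdom c p;
  atlas_compat : forall c d, atlas c -> atlas d -> forall i : 'I_3,
    smooth_on (cmap c @` (cdom c `&` cdom d))
      (fun x => cmap d (cinv c x) 0 i);
  lg_mul_cont : continuous (fun z : G * G => (z.1 * z.2)%g);
  lg_mul_smooth : forall c d e, atlas c -> atlas d -> atlas e ->
    forall i : 'I_3,
    smooth_on
      [set z : 'rV[R]_(3 + 3) | [/\ cimg c (lsubmx z), cimg d (rsubmx z) &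
         cdom e (cinv c (lsubmx z) * cinv d (rsubmx z))%g]]
      (fun z => cmap e (cinv c (lsubmx z) * cinv d (rsubmx z))%g 0 i);
  lg_inv_cont : continuous (fun p : G => (p^-1)%g);
  lg_inv_smooth : forall c d, atlas c -> atlas d -> forall i : 'I_3,
    smooth_on [set x | cimg c x /\ cdom d ((cinv c x)^-1)%g]
      (fun x => cmap d ((cinv c x)^-1)%g 0 i) }.

Section LieAlgebra.
Variables (R : realType) (G : topologicalGroupType) (L : lie_group3 R G).

Definition smooth_fun (f : G -> R) : Prop :=
  forall c, atlas L c -> smooth_on (cimg c) (f \o cinv c).

Definition smoothf := {f : G -> R | smooth_fun f}.

Definition smoothf_val (f : smoothf) : G -> R := proj1_sig f.
Coercion smoothf_val : smoothf >-> Funclass.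

(* Smooth vector fields on G are the derivations of its algebra of smooth
   functions.  The algebra structure is used through its graph, e.g. [h] below
   is the function a f + g, resp. f g. *)
Definition is_derivation (X : smoothf -> smoothf) : Prop :=
  (forall (a : R) (f g h : smoothf), (forall p, h p = a * f p + g p) ->
     forall p, X h p = a * X f p + X g p) /\
  (forall f g h : smoothf, (forall p, h p = f p * g p) ->
     forall p, X h p = X f p * g p + f p * X g p).

Definition left_invariant (X : smoothf -> smoothf) : Prop :=
  forall (a : G) (f h : smoothf), (forall p, h p = f (a * p)%g) ->
    forall p, X h p = X f (a * p)%g.

Definition lie_alg : set (smoothf -> smoothf) :=
  [set X | is_derivation X /\ left_invariant X].

Definition is_bracket (X Y Z : smoothf -> smoothf) : Prop :=
  forall f p, Z f p = X (Y f) p - Y (X f) p.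

(* Y is the push-forward of X by the right translation p |-> p a. *)
Definition right_translate (a : G) (X Y : smoothf -> smoothf) : Prop :=
  forall f h : smoothf, (forall p, h p = f (p * a)%g) ->
    forall p, Y f (p * a)%g = X h p.

(* A left-invariant Riemannian metric is an inner product on the Lie algebra;
   it is bi-invariant when right translations are isometries as well.  The
   last field is the infinitesimal form of [bi_right]: it is implied by it, and
   equivalent to it when G is connected. *)
Record bi_invariant_metric (ip : (smoothf -> smoothf) -> (smoothf -> smoothf) -> R)
    : Prop := BiInvariantMetric {
  bi_sym : forall X Y, lie_alg X -> lie_alg Y -> ip X Y = ip Y X;
  bi_lin : forall (a : R) X Y Z W,
    lie_alg X -> lie_alg Y -> lie_alg Z -> lie_alg W ->
    (forall f p, W f p = a * Y f p + Z f p) ->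
    ip X W = a * ip X Y + ip X Z;
  bi_pos : forall X, lie_alg X -> (exists f p, X f p != 0) -> 0 < ip X X;
  bi_right : forall (a : G) X X' Y Y',
    lie_alg X -> lie_alg X' -> lie_alg Y -> lie_alg Y' ->
    right_translate a X X' -> right_translate a Y Y' -> ip X' Y' = ip X Y;
  bi_ad : forall X Y Z XY YZ,
    lie_alg X -> lie_alg Y -> lie_alg Z -> lie_alg XY -> lie_alg YZ ->
    is_bracket X Y XY -> is_bracket Y Z YZ -> ip X YZ = ip XY Z }.

Definition orthonormal_basis (ip : (smoothf -> smoothf) -> (smoothf -> smoothf) -> R)
    (X : 'I_3 -> smoothf -> smoothf) : Prop :=
  [/\ forall i, lie_alg (X i),
      forall i j, ip (X i) (X j) = (i == j)%:R &
      forall Y, lie_alg Y -> exists y : 'rV[R]_3,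
        forall f p, Y f p = \sum_i y 0 i * X i f p].

(* [X_i, X_j] = \sum_k c i j k X_k *)
Definition structure_constants (X : 'I_3 -> smoothf -> smoothf)
    (c : 'I_3 -> 'I_3 -> 'I_3 -> R) : Prop :=
  forall i j f p,
    X i (X j f) p - X j (X i f) p = \sum_k c i j k * X k f p.

Definition smooth_curve (I : set R) (alpha : R -> G) : Prop :=
  (forall s, I s -> {for s, continuous alpha}) /\
  (forall c, atlas L c -> forall i : 'I_3,
     smooth_on1 (I `&` alpha @^-1` cdom c) (fun s => cmap c (alpha s) 0 i)).

(* alpha'(s) = \sum_i (T s)_i X_i, as tangent vectors at alpha(s) *)
Definition has_velocity (X : 'I_3 -> smoothf -> smoothf) (I : set R) (alpha : R -> G)
    (T : R -> 'rV[R]_3) : Prop :=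
  forall s, I s -> forall f : smoothf,
    is_derive s 1 (f \o alpha) (\sum_i T s 0 i * X i f (alpha s)).

End LieAlgebra.

(* From here on an element of the Lie algebra is the row of its coordinates in
   an orthonormal basis X_1, X_2, X_3, which is taken to be positively
   oriented, and c denotes the structure constants of that basis. *)
Section Curves.
Variables (R : realType) (c : 'I_3 -> 'I_3 -> 'I_3 -> R).
Implicit Types (I : set R) (u v : 'rV[R]_3) (V W T N B : R -> 'rV[R]_3).

Definition dotp u v : R := \sum_i u 0 i * v 0 i.

Definition vnorm u : R := Num.sqrt (dotp u u).

(* indices are added modulo 3 *)
Definition crossp u v : 'rV[R]_3 :=
  \row_(k < 3) (u 0 (k + 1) * v 0 (k + 2) - u 0 (k + 2) * v 0 (k + 1)).

Definition lie_br u v : 'rV[R]_3 :=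
  \row_k \sum_i \sum_j u 0 i * v 0 j * c i j k.

Definition smooth_field I W : Prop :=
  forall i : 'I_3, smooth_on1 I (fun s => W s 0 i).

Definition dot W : R -> 'rV[R]_3 :=
  fun s => \row_i derive1 (fun t => W t 0 i) s.

(* covariant derivative of W along a curve of velocity V *)
Definition Dalong V W : R -> 'rV[R]_3 :=
  fun s => dot W s + 2^-1 *: lie_br (V s) (W s).

(* Frenet frame of a curve of velocity V = v T, in an arbitrary parameter;
   k and t are the curvature and the torsion multiplied by the speed v, hence
   the curvature and the torsion themselves when v = 1. *)
Definition frenet_frame I V (v : R -> R) T N B (k t : R -> R) : Prop :=
  [/\ smooth_field I T, smooth_field I N & smooth_field I B] /\
  forall s, I s ->
    [/\ V s = v s *: T s,
        [/\ dotp (T s) (T s) = 1, dotp (N s) (N s) = 1,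
            dotp (T s) (N s) = 0 & B s = crossp (T s) (N s)],
        Dalong V T s = k s *: N s,
        Dalong V N s = - k s *: T s + t s *: B s &
        Dalong V B s = - t s *: N s].

(* Frenet apparatus of a curve parametrized by arc length, with velocity T;
   the curvature does not vanish, so that the principal normal and the harmonic
   curvature function make sense. *)
Definition frenet_apparatus I T N B (kappa tau : R -> R) : Prop :=
  frenet_frame I T (fun=> 1) T N B kappa tau /\
  forall s, I s -> kappa s = vnorm (dot T s) /\ 0 < kappa s.

Definition tau_G T N B : R -> R :=
  fun s => 2^-1 * dotp (lie_br (T s) (N s)) (B s).

Definition harmonic_curvature T N B (kappa tau : R -> R) : R -> R :=
  fun s => (tau s - tau_G T N B s) / kappa s.

(* The relation beta = alpha + lam N has a meaning in G only through its
   derivative, computed componentwise; it determines beta up to a left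
   translation, and beta(s) corresponds to alpha(s). *)
Definition mate_velocity T N (lam : R -> R) : R -> 'rV[R]_3 :=
  fun s => T s + derive1 lam s *: N s + lam s *: dot N s.

Definition lin_dep u v : Prop :=
  exists a b : R, (a, b) != (0, 0) /\ a *: u + b *: v = 0.

(* beta = alpha + lam N has unit tangent Tb, with v = d(sbar)/ds for sbar the
   (oriented) arc length of beta.  No regularity of beta is imposed: v may
   vanish (for a circle in R^3 the mate is its centre), and so may the
   curvature of beta (for a circular helix the mate is its axis).  Wherever
   v and k do not vanish, the line spanned by Bb is the usual binormal line. *)
Definition mannheim_mate I T N (lam : R -> R) : Prop :=
  exists (v : R -> R) Tb Nb Bb (k t : R -> R),
    [/\ smooth_on1 I v,
        frenet_frame I (mate_velocity T N lam) v Tb Nb Bb k t &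
        forall s, I s -> lin_dep (N s) (Bb s)].

Definition mannheim I T N : Prop :=
  exists2 lam : R -> R, smooth_on1 I lam & mannheim_mate I T N lam.

End Curves.

(* Main.v *)
(* As the structure constants are totally antisymmetric in an orthonormal basis,
   [u, v] = g u x v for a constant g.  Hence tau_G = g / 2, and with
   sigma = tau - tau_G the frame of alpha satisfies the Frenet equations of
   Euclidean space for the componentwise derivative, with torsion sigma.  Then
     V = (1 - lam kappa) T + lam' N + lam sigma B
   is the velocity of the mate.  If N is parallel to the binormal of the mate,
   then V is orthogonal to N, so lam' = 0; and T_beta and its derivative are
   orthogonal to N, so that N' is orthogonal to V, which reads
   lam (kappa^2 + sigma^2) = kappa.  Conversely, if this holds for a constant
   lam, then V is proportional to sigma T + kappa B, and the Frenet frame of the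
   mate can be written down. *)
Require Import Defs.
From mathcomp Require Import all_boot all_order all_algebra.
From mathcomp Require Import all_classical all_reals all_analysis.
From mathcomp Require Import ring lra.

Import Order.TTheory GRing.Theory Num.Theory.
Import numFieldNormedType.Exports.

Local Open Scope classical_set_scope.
Local Open Scope ring_scope.

Set Implicit Arguments.
Unset Strict Implicit.

(** * Indices in ['I_3], with arithmetic modulo 3 *)

Variant I3_spec : 'I_3 -> Prop :=
| I3_0 : I3_spec 0
| I3_1 : I3_spec 1
| I3_2 : I3_spec 2.

Lemma I3P i : I3_spec i.
Proof.
case: i => -[|[|[|]]]// lei.
- by rewrite (_ : Ordinal _ = 0); [exact: I3_0|exact/val_inj].
- by rewrite (_ : Ordinal _ = 1); [exact: I3_1|exact/val_inj].
- by rewrite (_ : Ordinal _ = 2); [exact: I3_2|exact/val_inj].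
Qed.

Lemma sum3 (V : nmodType) (F : 'I_3 -> V) : \sum_i F i = F 0 + (F 1 + F 2).
Proof.
rewrite !big_ord_recl big_ord0 addr0.
by congr (F _ + (F _ + F _)); exact/val_inj.
Qed.

Lemma I3E : ((0 + 1)%R = 1%R :> 'I_3) * ((0 + 2)%R = 2%R :> 'I_3) *
  ((1 + 1)%R = 2%R :> 'I_3) * ((1 + 2)%R = 0%R :> 'I_3) *
  ((2 + 1)%R = 0%R :> 'I_3) * ((2 + 2)%R = 1%R :> 'I_3).
Proof. by do ![split]; exact/val_inj. Qed.

(** * Linear combinations of smooth functions on open sets and on the group *)

(** The first-order expansion depends only on the germ, so ['d f x] also expands [g] at [x];
    uniqueness of the differential identifies it with ['d g x]. *)
Lemma near_eq_differentiable (R : numFieldType) (V W : normedModType R)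
    (f g : V -> W) (x : V) :
  {near x, f =1 g} -> differentiable f x -> differentiable g x.
Proof.
move=> fg df.
have cdf : continuous ('d f x) by exact: diff_continuous.
have gE : g \o shift x = cst (g x) + 'd f x +o_ 0 id.
  have /eqaddoP fo := diff_locally df.
  apply/eqaddoP => e e0.
  have fg0 : \forall h \near 0, f (h + x) = g (h + x).
    have /= := fg; rewrite (near_shift 0 x) => h.
    by move: h; apply: filterS => h /=; rewrite subr0.
  apply: filterS2 fg0 (fo e e0) => h fgh.
  by rewrite !fctE /= fgh (nbhs_singleton fg).
by apply/diff_locallyP; rewrite (diff_unique cdf gE).
Qed.

(** Asking for the equality on [U] only makes the induction on [k] pass: the partial derivatives are
    again related on [U] alone, because [U] is open. *)
Lemma Ck_linear (R : realType) (n k : nat) (U : set 'rV[R]_n) (a : R)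
    (f g h : 'rV[R]_n -> R) :
  open U -> (forall x, U x -> h x = a * f x + g x) ->
  Ck k U f -> Ck k U g -> Ck k U h.
Proof.
move=> oU; elim: k f g h => [|k IH] f g h hE /=.
  move=> cf cg x Ux.
  have hx : \forall y \near x, (a \*: f + g) y = h y.
    by near=> y; rewrite hE//; near: y; exact: open_nbhs_nbhs.
  rewrite /prop_for /continuous_at -(nbhs_singleton hx).
  apply: cvg_trans (near_eq_cvg hx) _.
  by apply: cvgD; [apply: cvgZl_tmp; exact: cf|exact: cg].
move=> [df Df] [dg Dg]; have hx x : U x ->
    \forall y \near x, (a \*: f + g) y = h y.
  by move=> Ux; near=> y; rewrite hE//; near: y; exact: open_nbhs_nbhs.
split=> [x Ux|i].
  apply: near_eq_differentiable (hx x Ux) _.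
  by apply: differentiableD; [apply: differentiableZ; exact: df|exact: dg].
apply: IH (Df i) (Dg i) => x Ux.
rewrite -(near_eq_derive _ (hx x Ux)) deriveD ?deriveZ//.
- exact/diff_derivable/df.
- exact/derivableZ/diff_derivable/df.
- exact/diff_derivable/dg.
Unshelve. all: by end_near. Qed.

Lemma smooth_fun_linear (R : realType) (G : topologicalGroupType)
    (L : lie_group3 R G) (a : R) (f g : G -> R) :
  smooth_fun L f -> smooth_fun L g -> smooth_fun L (fun p => a * f p + g p).
Proof.
move=> sf sg c ac k; apply: (Ck_linear (a := a)) (sf c ac k) (sg c ac k) => //.
exact: cimg_open (atlas_chart ac).
Qed.

(** * Total antisymmetry of the structure constants *)

Section LieBracket.
Variables (R : realType) (G : topologicalGroupType) (L : lie_group3 R G).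
Variables (ip : (smoothf L -> smoothf L) -> (smoothf L -> smoothf L) -> R).
Hypothesis hip : bi_invariant_metric ip.
Variable X : 'I_3 -> smoothf L -> smoothf L.
Hypothesis hX : orthonormal_basis ip X.
Variable c : 'I_3 -> 'I_3 -> 'I_3 -> R.
Hypothesis hc : structure_constants X c.

(** A field sends smooth functions to smooth functions, so a combination of fields has to carry the
    smoothness proof of its values. *)
Definition vf_linear (a : R) (Y Z : smoothf L -> smoothf L) :
    smoothf L -> smoothf L :=
  fun f => exist _ _ (smooth_fun_linear a (proj2_sig (Y f)) (proj2_sig (Z f))).

Lemma vf_linearE a Y Z f p : vf_linear a Y Z f p = a * Y f p + Z f p.
Proof. by []. Qed.

Lemma lie_alg_linear a Y Z :
  lie_alg Y -> lie_alg Z -> lie_alg (vf_linear a Y Z).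
Proof.
move=> [[Yl Ym] Yi] [[Zl Zm] Zi]; split; first split.
- move=> b f g h hE p; rewrite !vf_linearE (Yl b f g h)// (Zl b f g h)//; ring.
- by move=> f g h hE p; rewrite !vf_linearE (Ym f g h)// (Zm f g h)//; ring.
- by move=> g f h hE p; rewrite !vf_linearE (Yi g f h)// (Zi g f h).
Qed.

Lemma ip_linear a V Y Z : lie_alg V -> lie_alg Y -> lie_alg Z ->
  ip V (vf_linear a Y Z) = a * ip V Y + ip V Z.
Proof.
by move=> hV hY hZ; apply: (bi_lin hip) => //; exact: lie_alg_linear.
Qed.

Let X_lie i : lie_alg (X i). Proof. by case: hX. Qed.

(** The field [X_i, X_j], expanded in the basis. The innermost term [- X 0 + X 0] stands for the
    zero field, which ends the chain of combinations. *)
Let bracket i j := vf_linear (c i j 0) (X 0)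
  (vf_linear (c i j 1) (X 1)
    (vf_linear (c i j 2) (X 2) (vf_linear (- 1) (X 0) (X 0)))).

Let bracket_lie i j : lie_alg (bracket i j).
Proof. by do 4! [apply: lie_alg_linear => //]. Qed.

Let bracketP i j : is_bracket (X i) (X j) (bracket i j).
Proof.
by move=> f p; rewrite hc sum3 !vf_linearE; ring.
Qed.

Let ip_bracket k i j : ip (X k) (bracket i j) = c i j k.
Proof.
rewrite !ip_linear//; try by do 3? [apply: lie_alg_linear => //].
have [_ ipX _] := hX; rewrite !ipX; case: (I3P k);
by rewrite /= ?mulr1 ?mulr0 ?addr0 ?add0r ?mulN1r ?addNr ?addr0.
Qed.

(** By orthonormality c i j k is the inner product of [X_i, X_j] with X_k, so this is [bi_ad] read
    on basis vectors. *)
Lemma structure_constants_cyclic i j k : c j k i = c i j k.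
Proof.
rewrite -!ip_bracket (bi_sym hip (X_lie k) (bracket_lie i j)).
exact: (bi_ad hip (X_lie i) (X_lie j) (X_lie k) (bracket_lie i j)
  (bracket_lie j k) (@bracketP i j) (@bracketP j k)).
Qed.

Lemma structure_constants_antisym i j k : c j i k = - c i j k.
Proof.
apply/eqP; rewrite -addr_eq0 addrC -!ip_bracket; apply/eqP.
pose W := vf_linear 1 (bracket i j) (bracket j i).
transitivity (ip (X k) W).
  by rewrite [RHS]ip_linear// mul1r.
(* [W] takes the same values as [- X 0 + X 0], and [bi_lin] asks for equality of values only; hence
   the inner product of [W] with [X k] cancels. *)
rewrite (bi_lin hip (X_lie k) (X_lie 0) (X_lie 0) (_ : lie_alg W)
  (a := - 1)).
- by rewrite mulN1r addNr.
- exact: lie_alg_linear.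
by move=> f p; rewrite vf_linearE (@bracketP i j f p) (@bracketP j i f p); ring.
Qed.

(** Cyclicity and antisymmetry kill every constant with a repeated index and turn the others into
    plus or minus [c 0 1 2], according to the sign of the permutation. *)
Lemma lie_brE u v : lie_br c u v = c 0 1 2 *: crossp u v.
Proof.
have c0 i k : c i i k = 0.
  by have := structure_constants_antisym i i k; lra.
have c1 i k : c i k i = 0 by rewrite structure_constants_cyclic.
have c2 i k : c k i i = 0 by rewrite -structure_constants_cyclic.
have c120 : c 1 2 0 = c 0 1 2 := structure_constants_cyclic _ _ _.
have c201 : c 2 0 1 = c 0 1 2
  := etrans (structure_constants_cyclic _ _ _) c120.
apply/rowP; case/I3P; rewrite !mxE !sum3 ?I3E ?(c0, c1, c2).
- by rewrite (structure_constants_antisym 1 2) c120; ring.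
- by rewrite (structure_constants_antisym 2 0) c201; ring.
- by rewrite (structure_constants_antisym 0 1); ring.
Qed.

End LieBracket.

(** * Smooth functions of one real variable *)

Section SmoothCalculus.
Variables (R : realType) (I : set R).
Hypothesis I_open : open I.
Implicit Types f g h : R -> R.

(* The formal derivative of an expression is again an expression, up to equality
   on I: one induction gives all closure properties of [smooth_on1]. *)
Inductive smooth_expr : (R -> R) -> Prop :=
| expr_smooth f : smooth_on1 I f -> smooth_expr f
| exprD f g : smooth_expr f -> smooth_expr g ->
    smooth_expr (fun s => f s + g s)
| exprM f g : smooth_expr f -> smooth_expr g ->
    smooth_expr (fun s => f s * g s)
| expr_sqrtV f : smooth_expr f -> (forall s, I s -> 0 < f s) ->
    smooth_expr (fun s => (Num.sqrt (f s))^-1).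

Lemma near_eq_open f g s :
  (forall s, I s -> f s = g s) -> I s -> {near s, f =1 g}.
Proof.
by move=> fg Is; near=> t; apply: fg; near: t; exact: open_nbhs_nbhs.
Unshelve. all: by end_near. Qed.

Lemma smooth_on1_derivable f s : smooth_on1 I f -> I s -> derivable f s 1.
Proof. by move=> sf; exact: (sf 0%N). Qed.

Lemma smooth_on1_derive1 f : smooth_on1 I f -> smooth_on1 I (derive1 f).
Proof. by move=> sf n s Is; rewrite -derive1Sn; exact: sf. Qed.

Lemma smooth_on1_cst (a : R) : smooth_on1 I (cst a).
Proof.
move=> n s _; elim: n a => [|n IH] a; first exact: derivable_cst.
by rewrite derive1Sn (_ : derive1 (cst a) = cst 0)//; exact/funext/derive1_cst.
Qed.

Lemma smooth_expr_is_derive f : smooth_expr f ->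
  exists2 f', smooth_expr f' & forall s, I s -> is_derive s 1 f (f' s).
Proof.
elim=> {f} [f sf|f g _ [f' ef' df] _ [g' eg' dg]
  |f g ef [f' ef' df] eg [g' eg' dg]|f ef [f' ef' df] f_gt0].
- exists (derive1 f); first exact/expr_smooth/smooth_on1_derive1.
  move=> s Is; rewrite derive1E; apply: derivableP.
  exact: smooth_on1_derivable.
- exists (fun s => f' s + g' s); first exact: exprD.
  by move=> s Is; have := df s Is; have := dg s Is => ? ?; exact: is_deriveD.
- exists (fun s => f s * g' s + g s * f' s).
    by apply: exprD; exact: exprM.
  by move=> s Is; have := df s Is; have := dg s Is => ? ?; exact: is_deriveM.
- have es : smooth_expr (fun s => (Num.sqrt (f s))^-1) by exact: expr_sqrtV.
  (* The derivative of f^(-1/2) is - f' / 2 times the cube of f^(-1/2): as a product of expressions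
     it stays in the class. *)
  exists (fun s => - 2^-1 * (f' s * ((Num.sqrt (f s))^-1 *
      ((Num.sqrt (f s))^-1 * (Num.sqrt (f s))^-1)))).
    by do ! apply: exprM => //; exact/expr_smooth/smooth_on1_cst.
  move=> s Is; have fs := f_gt0 s Is.
  have sfs : Num.sqrt (f s) != 0 by rewrite gt_eqF// sqrtr_gt0.
  have dfs := df s Is.
  have dsqrt := is_derive1_sqrt fs.
  have dcomp : is_derive s 1 (fun s => Num.sqrt (f s))
      ((2 * Num.sqrt (f s))^-1 * f' s).
    exact: is_derive1_comp.
  have [dV dVE] := @is_deriveV _ (fun s => Num.sqrt (f s)) _ _ _ sfs dcomp.
  apply: DeriveDef; [exact: dV | rewrite dVE].
  by rewrite /GRing.scale/=; field.
Qed.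

(** Induction on the order of differentiation, with [f] and [h] varying: on the open set [I] the
    derivative of [h] again agrees with an expression. *)
Lemma smooth_expr_on1 f h : smooth_expr f ->
  (forall s, I s -> h s = f s) -> smooth_on1 I h.
Proof.
move=> ef hf n; elim: n f h ef hf => [|n IH] f h ef hf s Is.
  have [f' _ df] := smooth_expr_is_derive ef.
  have fh : {near s, f =1 h} by apply: near_eq_open => // t It; rewrite hf.
  by apply: (near_eq_derivable fh); case: (df s Is).
have [f' ef' df] := smooth_expr_is_derive ef.
rewrite derive1Sn; apply: IH ef' _ s Is => t It.
rewrite derive1E (near_eq_derive _ (near_eq_open hf It)).
by have := df t It => ?; exact: derive_val.
Qed.

Lemma smooth_on1D f g : smooth_on1 I f -> smooth_on1 I g ->
  smooth_on1 I (fun s => f s + g s).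
Proof.
by move=> sf sg; apply: smooth_expr_on1 => //; apply: exprD; exact: expr_smooth.
Qed.

Lemma smooth_on1M f g : smooth_on1 I f -> smooth_on1 I g ->
  smooth_on1 I (fun s => f s * g s).
Proof.
by move=> sf sg; apply: smooth_expr_on1 => //; apply: exprM; exact: expr_smooth.
Qed.

Lemma smooth_on1N f : smooth_on1 I f -> smooth_on1 I (fun s => - f s).
Proof.
move=> sf; have sfN : smooth_expr (fun s => cst (- 1) s * f s).
  by apply: exprM; apply: expr_smooth => //; exact: smooth_on1_cst.
by apply: (smooth_expr_on1 sfN) => s _; rewrite mulN1r.
Qed.

Lemma smooth_on1_sqrtV f : smooth_on1 I f -> (forall s, I s -> 0 < f s) ->
  smooth_on1 I (fun s => (Num.sqrt (f s))^-1).
Proof.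
move=> sf f0; apply: smooth_expr_on1 => //.
by apply: expr_sqrtV => //; exact: expr_smooth.
Qed.

(** The mean value theorem on the segment from [s] to [t], which lies in [I] because [I] is an
    interval. *)
Lemma derive1_eq0_cst f s t : is_interval I ->
  (forall u, I u -> is_derive u 1 f 0) -> I s -> I t -> f s = f t.
Proof.
move=> itv df; wlog st : s t / s <= t.
  by move=> W Is It; case: (leP s t) => [|/ltW] st; [|symmetry]; exact: W.
move=> Is It.
have sub u : s <= u <= t -> I u by exact: itv.
have df0 u : u \in `[s, t]%R -> is_derive u 1 f 0.
  by rewrite in_itv => su; exact/df/sub.
have cf : {within `[s, t], continuous f}.
  by apply: derivable_within_continuous => u /df0[].
have df0' u : u \in `]s, t[%R -> is_derive u 1 f 0.
  by move=> su; apply: df0; exact: subset_itv_oo_cc su.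
have [u _] := MVT_segment st df0' cf.
by rewrite mul0r => /subr0_eq.
Qed.

End SmoothCalculus.

(** * Inner and cross products in dimension three, and the componentwise derivative *)

Section VectorAlgebra.
Variable R : realType.
Implicit Types u v w : 'rV[R]_3.

Lemma dotpC u v : dotp u v = dotp v u.
Proof. by rewrite /dotp !sum3; ring. Qed.

Lemma dotpDr u v w : dotp u (v + w) = dotp u v + dotp u w.
Proof. by rewrite /dotp !sum3 !mxE; ring. Qed.

Lemma dotpZr a u v : dotp u (a *: v) = a * dotp u v.
Proof. by rewrite /dotp !sum3 !mxE; ring. Qed.

Lemma dotpDl u v w : dotp (u + v) w = dotp u w + dotp v w.
Proof. by rewrite dotpC dotpDr !(dotpC w). Qed.

Lemma dotpZl a u v : dotp (a *: u) v = a * dotp u v.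
Proof. by rewrite dotpC dotpZr dotpC. Qed.

Lemma crossp_anti u v : crossp v u = - crossp u v.
Proof. by apply/rowP => k; rewrite !mxE; ring. Qed.

Lemma crosspp u : crossp u u = 0.
Proof. by apply/rowP => k; rewrite !mxE; ring. Qed.

Lemma crosspDr u v w : crossp u (v + w) = crossp u v + crossp u w.
Proof. by apply/rowP => k; rewrite !mxE; ring. Qed.

Lemma crosspZr a u v : crossp u (a *: v) = a *: crossp u v.
Proof. by apply/rowP => k; rewrite !mxE; ring. Qed.

Lemma crosspDl u v w : crossp (u + v) w = crossp u w + crossp v w.
Proof. by apply/rowP => k; rewrite !mxE; ring. Qed.

Lemma crosspZl a u v : crossp (a *: u) v = a *: crossp u v.
Proof. by apply/rowP => k; rewrite !mxE; ring. Qed.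

Lemma dotp_crossl u v : dotp u (crossp u v) = 0.
Proof. by rewrite /dotp sum3 !mxE !I3E; ring. Qed.

Lemma dotp_crossr u v : dotp v (crossp u v) = 0.
Proof. by rewrite /dotp sum3 !mxE !I3E; ring. Qed.

Lemma crossp_crosspl u v :
  crossp u (crossp u v) = dotp u v *: u - dotp u u *: v.
Proof.
by apply/rowP; case/I3P; rewrite /dotp !sum3 !mxE !I3E; ring.
Qed.

Lemma crossp_crosspr u v :
  crossp v (crossp u v) = dotp v v *: u - dotp u v *: v.
Proof.
by apply/rowP; case/I3P; rewrite /dotp !sum3 !mxE !I3E; ring.
Qed.

Lemma dotp_crossp u v :
  dotp (crossp u v) (crossp u v) = dotp u u * dotp v v - dotp u v ^+ 2.
Proof. by rewrite /dotp !sum3 !mxE !I3E; ring. Qed.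

Lemma orthonormal_cross u v :
  dotp u u = 1 -> dotp v v = 1 -> dotp u v = 0 ->
  [/\ dotp (crossp u v) (crossp u v) = 1,
      crossp u (crossp u v) = - v & crossp v (crossp u v) = u].
Proof.
move=> uu vv uv; rewrite dotp_crossp crossp_crosspl crossp_crosspr uu vv uv.
by split; [ring|rewrite scale0r scale1r sub0r|rewrite scale0r scale1r subr0].
Qed.

Lemma lin_dep_unit u v :
  dotp u u = 1 -> dotp v v = 1 -> lin_dep u v -> exists a, u = a *: v.
Proof.
move=> uu vv [a [b [ab0 uv]]].
(* If [a] vanished, pairing [b *: v = 0] with the unit vector [v] would give [b = 0] as well. *)
have [a0|a0] := eqVneq a 0.
  move: uv ab0; rewrite a0 scale0r add0r => /(congr1 (dotp v)).
  rewrite dotpZr vv mulr1 => ->.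
  by rewrite /dotp sum3 !mxE !mulr0 !addr0 eqxx.
exists (- (a^-1 * b)).
move/eqP: uv; rewrite addr_eq0 => /eqP/(congr1 ( *:%R a^-1)).
by rewrite scalerA mulVf// scale1r => ->; rewrite scalerN scalerA scaleNr.
Qed.

Lemma dot_is_derive (I : set R) (W : R -> 'rV[R]_3) s i :
  smooth_field I W -> I s -> is_derive s 1 (fun t => W t 0 i) (dot W s 0 i).
Proof.
move=> sW Is; rewrite mxE derive1E; apply: derivableP.
exact: smooth_on1_derivable (sW i) Is.
Qed.

Lemma dotp_is_derive (I : set R) (W Z : R -> 'rV[R]_3) s :
  smooth_field I W -> smooth_field I Z -> I s ->
  is_derive s 1 (fun t => dotp (W t) (Z t))
    (dotp (dot W s) (Z s) + dotp (W s) (dot Z s)).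
Proof.
move=> sW sZ Is; have dW i := dot_is_derive i sW Is.
have dZ i := dot_is_derive i sZ Is.
have -> : (fun t => dotp (W t) (Z t)) =
    \sum_(i < 3) (fun t => W t 0 i * Z t 0 i).
  by apply/funext => t; rewrite fct_sumE.
apply: is_derive_eq; rewrite -big_split; apply: eq_bigr => i _ /=.
by rewrite /GRing.scale/=; ring.
Qed.

Lemma dot_linear (I : set R) (a b : R -> R) (W Z : R -> 'rV[R]_3) s :
  smooth_on1 I a -> smooth_on1 I b -> smooth_field I W -> smooth_field I Z ->
  I s ->
  dot (fun t => a t *: W t + b t *: Z t) s =
  derive1 a s *: W s + a s *: dot W s + (derive1 b s *: Z s + b s *: dot Z s).
Proof.
move=> sa sb sW sZ Is; apply/rowP => i.
have dW := dot_is_derive i sW Is; have dZ := dot_is_derive i sZ Is.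
have da : is_derive s 1 a (derive1 a s).
  by rewrite derive1E; apply: derivableP; exact: smooth_on1_derivable Is.
have db : is_derive s 1 b (derive1 b s).
  by rewrite derive1E; apply: derivableP; exact: smooth_on1_derivable Is.
rewrite [LHS]mxE derive1E.
have -> : (fun t => (a t *: W t + b t *: Z t) 0 i) =
    (a * (fun t => W t 0 i) + b * (fun t => Z t 0 i)).
  by apply/funext => t; rewrite !mxE.
rewrite derive_val; do 5 rewrite [in RHS]mxE.
by rewrite /GRing.scale/= !mxE; ring.
Qed.

Lemma smooth_field_dot (I : set R) (W : R -> 'rV[R]_3) :
  smooth_field I W -> smooth_field I (dot W).
Proof.
move=> sW i; rewrite (_ : (fun s => _) = derive1 (fun s => W s 0 i)).
  exact: smooth_on1_derive1.
by apply/funext => s; rewrite mxE.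
Qed.

Lemma smooth_field_linear (I : set R) (a b : R -> R) (W Z : R -> 'rV[R]_3) :
  open I -> smooth_on1 I a -> smooth_on1 I b ->
  smooth_field I W -> smooth_field I Z ->
  smooth_field I (fun t => a t *: W t + b t *: Z t).
Proof.
move=> oI sa sb sW sZ i.
rewrite (_ : (fun s => _) = (fun s => a s * W s 0 i + b s * Z s 0 i)).
  exact: (smooth_on1D oI (smooth_on1M oI sa (sW i)) (smooth_on1M oI sb (sZ i))).
by apply/funext => s; rewrite !mxE.
Qed.

Lemma smooth_on1_dotp (I : set R) (W Z : R -> 'rV[R]_3) :
  open I -> smooth_field I W -> smooth_field I Z ->
  smooth_on1 I (fun s => dotp (W s) (Z s)).
Proof.
move=> oI sW sZ.
rewrite (_ : (fun s => _) = (fun s => W s 0 0 * Z s 0 0 +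
    (W s 0 1 * Z s 0 1 + W s 0 2 * Z s 0 2))).
  have sM i := smooth_on1M oI (sW i) (sZ i).
  exact: (smooth_on1D oI (sM 0) (smooth_on1D oI (sM 1) (sM 2))).
by apply/funext => s; rewrite /dotp sum3.
Qed.

End VectorAlgebra.

(** * Frenet equations for the componentwise derivative, and necessity *)

Section MannheimCurve.
Variables (R : realType) (c : 'I_3 -> 'I_3 -> 'I_3 -> R) (g : R).
Hypothesis brE : forall u v, lie_br c u v = g *: crossp u v.
Variable I : set R.
Hypothesis I_open : open I.

(* The connection only shifts the torsion, by the multiple g v / 2 of the
   speed, since [T, N] = g B. *)
Lemma frenet_dot V v T N B k t s :
  frenet_frame c I V v T N B k t -> I s ->
  [/\ dot T s = k s *: N s,
      dot N s = - k s *: T s + (t s - 2^-1 * (g * v s)) *: B s &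
      dot B s = - (t s - 2^-1 * (g * v s)) *: N s].
Proof.
move=> [_ frenet] Is; have [Vs [TT NN TN Bs] DT DN DB] := frenet s Is.
have [_ TB _] := orthonormal_cross TT NN TN; rewrite -Bs in TB.
move: DT DN DB; rewrite /Dalong !brE !Vs !crosspZl crosspp TB -Bs.
rewrite !scaler0 addr0 => -> /(canRL (addrK _)) -> /(canRL (addrK _)) ->.
by split=> //; apply/rowP => i; rewrite !mxE; ring.
Qed.

Variables (T N B : R -> 'rV[R]_3) (kappa tau : R -> R).
Hypothesis frenet : frenet_apparatus c I T N B kappa tau.

Let sigma s := tau s - tau_G c T N B s.

Let frame s : I s -> [/\ dotp (T s) (T s) = 1, dotp (N s) (N s) = 1,
  dotp (T s) (N s) = 0 & B s = crossp (T s) (N s)].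
Proof. by have [[_ fr] _] := frenet => /fr[]. Qed.

Let frameB s : I s -> [/\ dotp (B s) (B s) = 1, dotp (T s) (B s) = 0,
  dotp (N s) (B s) = 0, crossp (T s) (B s) = - N s &
  crossp (N s) (B s) = T s].
Proof.
move=> /frame[TT NN TN ->]; have [? ? ?] := orthonormal_cross TT NN TN.
by rewrite dotp_crossl dotp_crossr.
Qed.

Lemma tau_G_cst s : I s -> tau_G c T N B s = 2^-1 * g.
Proof.
move=> Is; have [_ _ _ BE] := frame Is; have [BB _ _ _ _] := frameB Is.
by rewrite /tau_G brE -BE dotpZl BB mulr1.
Qed.

Let dotE s : I s -> [/\ dot T s = kappa s *: N s,
  dot N s = - kappa s *: T s + sigma s *: B s & dot B s = - sigma s *: N s].
Proof.
move=> Is; have [fr _] := frenet; have := frenet_dot fr Is.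
by rewrite /sigma tau_G_cst// mulr1.
Qed.

Let kappa_gt0 s : I s -> 0 < kappa s.
Proof. by have [_ k0] := frenet => /k0[]. Qed.

(** The two forms differ by the factor [kappa s], which is positive. *)
Let mannheim_eq (lam : R) s : I s ->
  lam * (kappa s ^+ 2 + sigma s ^+ 2) = kappa s <->
  lam * kappa s * (1 + harmonic_curvature c T N B kappa tau s ^+ 2) = 1.
Proof.
move=> Is; have k0 := lt0r_neq0 (kappa_gt0 Is).
rewrite /harmonic_curvature -/(sigma s).
have -> : lam * kappa s * (1 + (sigma s / kappa s) ^+ 2) =
    lam * (kappa s ^+ 2 + sigma s ^+ 2) / kappa s by field.
split=> [->|/(congr1 ( *%R^~ (kappa s)))]; first by rewrite divff.
by rewrite mulfVK// mul1r.
Qed.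

Lemma mannheim_necessary : is_interval I -> I !=set0 -> mannheim c I T N ->
  exists lam : R, forall s, I s ->
    lam * kappa s * (1 + harmonic_curvature c T N B kappa tau s ^+ 2) = 1.
Proof.
move=> I_itv [s0 Is0] [lam slam [v [Tb [Nb [Bb [k [t [sv fr ld]]]]]]]].
have [[[[sT sN sB] _] _] [[sTb sNb sBb] frb]] := (frenet, fr).
have N_orth s : I s -> dotp (N s) (Tb s) = 0 /\ dotp (N s) (Nb s) = 0.
  move=> Is; have [_ [TTb NNb TNb BbE] _ _ _] := frb s Is.
  have [_ NN _ _] := frame Is; have := ld s Is.
  rewrite BbE => /lin_dep_unit[]//.
    by have [] := orthonormal_cross TTb NNb TNb.
  move=> a ->; rewrite !dotpZl !(dotpC (crossp _ _)).
  by rewrite dotp_crossl dotp_crossr !mulr0.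
(* The component of the mate velocity along [N] is [derive1 lam], while [v Tb] has none. *)
have dlam s : I s -> derive1 lam s = 0.
  move=> Is; have [_ NN TN _] := frame Is; have [_ _ NB _ _] := frameB Is.
  have [Vs _ _ _ _] := frb s Is; have [NTb _] := N_orth s Is.
  have := congr1 (dotp (N s)) Vs; rewrite dotpZr NTb mulr0 /mate_velocity.
  have [_ -> _] := dotE Is.
  rewrite !dotpDr !dotpZr dotpDr !dotpZr (dotpC _ (T s)) TN NN NB => <-.
  by ring.
have lam_cst s : I s -> lam s = lam s0.
  move=> Is; apply: derive1_eq0_cst I_itv _ Is Is0 => u Iu.
  rewrite -(dlam u Iu) derive1E; apply: derivableP.
  exact: smooth_on1_derivable Iu.
exists (lam s0) => s Is; apply/mannheim_eq => //; rewrite -(lam_cst s Is).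
have [TT NN TN _] := frame Is; have [BB TB NB _ _] := frameB Is.
have [_ dN _] := dotE Is; have [Vs _ _ _ _] := frb s Is.
have [dTb _ _] := frenet_dot fr Is; have [NTb NNb] := N_orth s Is.
(* Differentiate <N, Tb> = 0; the other term is k <N, Nb> = 0. *)
have dNTb : dotp (dot N s) (Tb s) = 0.
  have /(_ s) dd := dotp_is_derive sN sTb.
  have z0 : {near s, (fun u => dotp (N u) (Tb u)) =1 cst 0}.
    by apply: (near_eq_open I_open) Is => u /N_orth[].
  have [_] := near_eq_is_derive z0 (dd Is).
  by rewrite derive_cst dTb dotpZr NNb mulr0 addr0.
(* Multiplying by [v s], rather than dividing, covers the points where the mate is singular. The
   product expands to - kappa + lam (kappa^2 + sigma^2). *)
have : dotp (dot N s) (mate_velocity T N lam s) = 0.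
  by rewrite Vs dotpZr dNTb mulr0.
rewrite /mate_velocity dlam// dN !(dotpDr, dotpDl, dotpZr, dotpZl).
rewrite (dotpC (B s) (T s)) (dotpC (B s) (N s)).
rewrite TT TN BB TB NB => speed0.
by apply/eqP; rewrite -subr_eq0 -speed0; apply/eqP; ring.
Qed.

(** * Sufficiency: construction of the Frenet frame of the mate *)

Let smooth_frame : [/\ smooth_field I T, smooth_field I N & smooth_field I B].
Proof. by have [[]] := frenet. Qed.

(** Smoothness is assumed of the frame, not of [kappa] and [tau]. These inner products are smooth by
    construction and equal [kappa] and [sigma] on [I]. *)
Let curv s := dotp (dot T s) (N s).
Let tors s := dotp (dot N s) (B s).

Let curvE s : I s -> curv s = kappa s.
Proof.
move=> Is; have [dT _ _] := dotE Is; have [_ NN _ _] := frame Is.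
by rewrite /curv dT dotpZl NN mulr1.
Qed.

Let torsE s : I s -> tors s = sigma s.
Proof.
move=> Is; have [_ dN _] := dotE Is; have [BB TB _ _ _] := frameB Is.
by rewrite /tors dN dotpDl !dotpZl BB TB mulr0 add0r mulr1.
Qed.

Lemma mannheim_sufficient (lam : R) :
  (forall s, I s ->
    lam * kappa s * (1 + harmonic_curvature c T N B kappa tau s ^+ 2) = 1) ->
  mannheim c I T N.
Proof.
move=> hlam; exists (cst lam); first exact: smooth_on1_cst.
have [sT sN sB] := smooth_frame.
have scurv : smooth_on1 I curv.
  exact: (smooth_on1_dotp I_open (smooth_field_dot sT) sN).
have stors : smooth_on1 I tors.
  exact: (smooth_on1_dotp I_open (smooth_field_dot sN) sB).
pose f s := curv s * curv s + tors s * tors s.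
have sf : smooth_on1 I f.
  exact: (smooth_on1D I_open (smooth_on1M I_open scurv scurv)
    (smooth_on1M I_open stors stors)).
have f_gt0 s : I s -> 0 < f s.
  move=> Is; rewrite /f curvE//; have k0 := kappa_gt0 Is.
  by rewrite ltr_pwDl ?mulr_gt0// -expr2 sqr_ge0.
(* V = a (a T + b B) with a^2 + b^2 = 1: the mate has speed a, principal normal
   b T - a B and binormal N.  The pair (a, b) is proportional to
   (sigma, kappa). *)
pose h s := (Num.sqrt (f s))^-1.
have sh : smooth_on1 I h by exact: smooth_on1_sqrtV.
have hE s : I s -> h s ^+ 2 * f s = 1.
  move=> Is; rewrite exprVn sqr_sqrtr ?ltW ?f_gt0// mulVf//.
  exact/lt0r_neq0/f_gt0.
pose a s := tors s * h s; pose b s := curv s * h s.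
have sa : smooth_on1 I a := smooth_on1M I_open stors sh.
have sb : smooth_on1 I b := smooth_on1M I_open scurv sh.
have sNa : smooth_on1 I (fun s => - a s) := smooth_on1N I_open sa.
have abE s : I s -> a s ^+ 2 + b s ^+ 2 = 1.
  by move=> Is; rewrite -(hE s Is) /a /b /f; ring.
(* Half the derivative of a^2 + b^2 = 1. *)
have dabE s : I s -> a s * derive1 a s + b s * derive1 b s = 0.
  move=> Is.
  have da : is_derive s 1 a (derive1 a s).
    by rewrite derive1E; apply: derivableP; exact: smooth_on1_derivable Is.
  have db : is_derive s 1 b (derive1 b s).
    by rewrite derive1E; apply: derivableP; exact: smooth_on1_derivable Is.
  have dab : is_derive s 1 (a * a + b * b)
      (2 * (a s * derive1 a s + b s * derive1 b s)).
    by apply: is_derive_eq; rewrite /GRing.scale/=; ring.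
  have ab1 : {near s, a * a + b * b =1 cst 1}.
    by apply: (near_eq_open I_open) Is => u Iu; rewrite /= -(abE u Iu).
  have [_] := near_eq_is_derive ab1 dab; rewrite derive_cst => /esym/eqP.
  by rewrite mulf_eq0 pnatr_eq0 => /eqP.
(* [k] is the angular speed of the unit pair (a, b), so that a' = k b and b' = - k a. In [t],
   [f s * h s] is the square root of kappa^2 + sigma^2, the Euclidean torsion of the mate times its
   speed; the term in [g] undoes the shift of [frenet_dot] for the speed [a]. *)
pose k s := derive1 a s * b s - derive1 b s * a s.
pose t s := f s * h s + 2^-1 * (g * a s).
pose Tb s := a s *: T s + b s *: B s.
pose Nb s := b s *: T s + - a s *: B s.
have dNaE s : I s -> derive1 (fun s => - a s) s = - derive1 a s.
  move=> Is; rewrite derive1E -[fun s => _]/(- a) deriveN -?derive1E//.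
  exact: smooth_on1_derivable Is.
exists a, Tb, Nb, N, k, t; split; first exact: sa; last first.
  move=> s Is; exists 1, (- 1); rewrite scaleN1r scale1r subrr.
  by split=> //; apply/eqP => -[] /eqP; rewrite oner_eq0.
split; first split.
- exact: smooth_field_linear I_open sa sb sT sB.
- exact: smooth_field_linear I_open sb sNa sT sB.
- exact: sN.
move=> s Is.
have [TT NN TN BE] := frame Is; have [BB TB NB TxB NxB] := frameB Is.
have [dT dN dB] := dotE Is.
have ab := abE s Is; have dab := dabE s Is.
have TbNb : crossp (Tb s) (Nb s) = N s.
  rewrite /Tb /Nb crosspDl !crosspDr !crosspZl !crosspZr !crosspp TxB.
  rewrite (crossp_anti (T s)) TxB -[RHS]scale1r -ab.
  by apply/rowP => i; rewrite !mxE; ring.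
have TbN : crossp (Tb s) (N s) = - Nb s.
  rewrite /Tb /Nb crosspDl !crosspZl -BE (crossp_anti (N s)) NxB.
  by apply/rowP => i; rewrite !mxE; ring.
(* The hypothesis gives lam = h^2 kappa, whence 1 - lam kappa = h^2 sigma^2 = a^2 and lam sigma =
   h^2 kappa sigma = a b. *)
have Vs : mate_velocity T N (cst lam) s = a s *: Tb s.
  rewrite /mate_velocity derive1_cst scale0r addr0 dN.
  have := (mannheim_eq lam Is).2 (hlam s Is); have := hE s Is.
  rewrite /Tb /a /b /f curvE// torsE// => hf lamE.
  have -> : cst lam s = h s ^+ 2 * kappa s.
    by rewrite -[LHS]mulr1 -hf -[in RHS]lamE/=; ring.
  rewrite -[X in X + _ = _]scale1r -[in X in X + _ = _]hf.
  by apply/rowP => i; rewrite !mxE; ring.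
(* This cancels the component along [N] of the derivative of [Tb]. *)
have a_kappa : a s * kappa s = b s * sigma s.
  by rewrite /a /b curvE// torsE//; ring.
(* (a', b') is orthogonal to the unit vector (a, b), hence a multiple of (b, - a). *)
have da : derive1 a s = k s * b s.
  transitivity (derive1 a s * (a s ^+ 2 + b s ^+ 2) -
      a s * (a s * derive1 a s + b s * derive1 b s)).
    by rewrite ab dab mulr1 mulr0 subr0.
  by rewrite /k; ring.
have db : derive1 b s = - (k s * a s).
  transitivity (derive1 b s * (a s ^+ 2 + b s ^+ 2) -
      b s * (a s * derive1 a s + b s * derive1 b s)).
    by rewrite ab dab mulr1 mulr0 subr0.
  by rewrite /k; ring.
(* (kappa, sigma) has length [f s * h s] and direction (b, a); the next three identities are its
   length and its two coordinates. *)
have rE : f s * h s = b s * kappa s + a s * sigma s.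
  by rewrite /a /b /f curvE// torsE//; ring.
have rb : f s * h s * b s = kappa s.
  by rewrite -[RHS]mulr1 -(hE s Is) /b curvE//; ring.
have ra : f s * h s * a s = sigma s.
  by rewrite -[RHS]mulr1 -(hE s Is) /a torsE//; ring.
have dTb : dot Tb s = k s *: Nb s.
  rewrite (dot_linear sa sb sT sB Is) dT dB da db /Nb.
  rewrite [a s *: (kappa s *: _)]scalerA a_kappa.
  by apply/rowP => i; rewrite !mxE; ring.
have dNb : dot Nb s = - k s *: Tb s + (f s * h s) *: N s.
  rewrite (dot_linear sb sNa sT sB Is) dT dB dNaE// da db rE /Tb.
  by apply/rowP => i; rewrite !mxE; ring.
have dN' : dot N s = - (f s * h s) *: Nb s.
  rewrite dN /Nb -[X in - X *: _]rb -[X in X *: B s]ra.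
  by apply/rowP => i; rewrite !mxE; ring.
split.
- exact: Vs.
- split; rewrite ?TbNb//;
    rewrite /Tb /Nb !(dotpDl, dotpDr, dotpZl, dotpZr) (dotpC (B s)) TT TB BB.
  + by rewrite -[RHS]ab; ring.
  + by rewrite -[RHS]ab; ring.
  + by ring.
- by rewrite /Dalong brE Vs crosspZl crosspp !scaler0 addr0.
- rewrite /Dalong brE Vs crosspZl TbNb dNb /t.
  by apply/rowP => i; rewrite !mxE; ring.
- rewrite /Dalong brE Vs crosspZl dN' TbN /t.
  by apply/rowP => i; rewrite !mxE; ring.
Qed.

End MannheimCurve.

Unset Implicit Arguments.

Theorem theorem3p3 (R : realType) (G : topologicalGroupType)
    (L : lie_group3 R G)
    (ip : (smoothf L -> smoothf L) -> (smoothf L -> smoothf L) -> R)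
    (hip : bi_invariant_metric ip)
    (X : 'I_3 -> smoothf L -> smoothf L) (hX : orthonormal_basis ip X)
    (c : 'I_3 -> 'I_3 -> 'I_3 -> R) (hc : structure_constants X c)
    (I : set R) (I_open : open I) (I_itv : is_interval I) (I_neq0 : I !=set0)
    (alpha : R -> G) (halpha : smooth_curve L I alpha)
    (T N B : R -> 'rV[R]_3) (kappa tau : R -> R)
    (hT : has_velocity X I alpha T)
    (hfrenet : frenet_apparatus c I T N B kappa tau) :
  mannheim c I T N <->
  exists lam : R, forall s, I s ->
    lam * kappa s * (1 + harmonic_curvature c T N B kappa tau s ^+ 2) = 1.
Proof.
have brE := lie_brE hip hX hc; split.
  exact: (mannheim_necessary brE I_open hfrenet I_itv I_neq0).
by move=> [lam]; exact: (mannheim_sufficient brE I_open hfrenet).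
Qed.
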